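(* Let $f,g,F,\sigma,L_{\nabla g},L_{\nabla F}$ be as in the context. Let $\mu>0$, $\underline{\alpha}>0$ and $\beta\ge 0$ satisfy $$\mu(\sigma-L_{\nabla g}\underline{\alpha})>\beta(\mu^2+1),$$ and let $\overline{\alpha}>\underline{\alpha}$ be such that $M_1>M_2$, where $$M_1=\frac{\sigma-\overline{\alpha}L_{\nabla g}}{2\overline{\alpha}}-\frac{\mu\beta}{2\underline{\alpha}},\qquad M_2=\frac{\beta}{2\mu\underline{\alpha}}.$$ Assume that $f+g$ is coercive, i.e. $\lim_{\|x\|\to+\infty}(f+g)(x)=+\infty$, and that the function $$H:\mathbb{R}^m\times\mathbb{R}^m\to(-\infty,+\infty],\qquad H(x,y)=(f+g)(x)+M_2\|x-y\|^2,$$ is a KL function. Let $(x_n)_{n\in\mathbb{N}}$ be a sequence generated by Algorithm 1 (defined in the context) with the parameters $\underline{\alpha},\overline{\alpha},\beta$. Then: (a) $\sum_{n\in\mathbb{N}}\|x_{n+1}-x_n\|<+\infty$; (b) there exists $x\in\operatorname{crit}(f+g)$ such that $\lim_{n\to+\infty}x_n=x$.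
   Context: $\mathbb{N}=\{0,1,2,\dots\}$, $m\ge 1$, and $\mathbb{R}^m$ carries the Euclidean scalar product $\langle\cdot,\cdot\rangle$ and norm $\|\cdot\|$ (likewise $\mathbb{R}^m\times\mathbb{R}^m$). Setting. $f:\mathbb{R}^m\to(-\infty,+\infty]$ is proper (not identically $+\infty$), lower semicontinuous and bounded below. $g:\mathbb{R}^m\to\mathbb{R}$ is Fréchet differentiable with $L_{\nabla g}$-Lipschitz continuous gradient, $L_{\nabla g}\ge 0$. $F:\mathbb{R}^m\to\mathbb{R}$ is $\sigma$-strongly convex (i.e. $F-\frac{\sigma}{2}\|\cdot\|^2$ is convex), Fréchet differentiable, with $L_{\nabla F}$-Lipschitz continuous gradient, where $\sigma,L_{\nabla F}>0$. No convexity of $f$ or $g$ is assumed. The Bregman distance is $D_F(x,y)=F(x)-F(y)-\langle\nabla F(y),x-y\rangle$. Algorithm 1. Choose $x_0,x_1\in\mathbb{R}^m$, $\underline{\alpha},\overline{\alpha}>0$, $\beta\ge 0$ and sequences $(\alpha_n)_{n\ge1},(\beta_n)_{n\ge1}$ with $0<\underline{\alpha}\le\alpha_n\le\overline{\alpha}$ and $0\le\beta_n\le\beta$ for all $n\ge1$. A sequence $(x_n)_{n\in\mathbb{N}}$ is generated by Algorithm 1 if for all $n\ge 1$ $$x_{n+1}\in\operatorname{argmin}_{u\in\mathbb{R}^m}\{D_F(u,x_n)+\alpha_n\langle u,\nabla g(x_n)\rangle+\beta_n\langle u,x_{n-1}-x_n\rangle+\alpha_nf(u)\}.$$ (The argmin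 is a nonempty set, not necessarily a singleton; any selection is allowed.) Subdifferentials. For a proper lower semicontinuous $h:\mathbb{R}^d\to(-\infty,+\infty]$ with $\operatorname{dom}h=\{x:h(x)<+\infty\}$ and $x\in\operatorname{dom}h$, the Fréchet subdifferential is $$\hat\partial h(x)=\Big\{v\in\mathbb{R}^d:\liminf_{y\to x}\frac{h(y)-h(x)-\langle v,y-x\rangle}{\|y-x\|}\ge0\Big\},$$ and the limiting subdifferential is $$\partial h(x)=\{v:\exists x_n\to x,\ h(x_n)\to h(x),\ \exists v_n\in\hat\partial h(x_n),\ v_n\to v\};$$ both are empty for $x\notin\operatorname{dom}h$. Put $\operatorname{crit}(h)=\{x:0\in\partial h(x)\}$ and $\operatorname{dom}\partial h=\{x:\partial h(x)\ne\emptyset\}$. KL functions. For $\eta\in(0,+\infty]$, $\Theta_\eta$ is the class of concave continuous functions $\varphi:[0,\eta)\to[0,+\infty)$ with $\varphi(0)=0$, $\varphi$ continuously differentiable on $(0,\eta)$ and $\varphi'(s)>0$ for all $s\in(0,\eta)$. For a set $A$, $\operatorname{dist}(x,A)=\inf_{y\in A}\|x-y\|$ (with $\inf\emptyset=+\infty$). A proper lower semicontinuous $h$ satisfies the Kurdyka-Łojasiewicz (KL) property at $\bar x\in\operatorname{dom}\partial h$ if there exist $\eta\in(0,+\infty]$, a neighborhood $U$ of $\bar x$ and $\varphi\in\Theta_\eta$ such that for all $x\in U$ with $h(\bar x)<h(x)<h(\bar x)+\eta$ one has $\varphi'(h(x)-h(\bar x))\operatorname{dist}(0,\partial h(x))\ge1$.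 $h$ is a KL function if it satisfies the KL property at each point of $\operatorname{dom}\partial h$. *)

(* Defs.v *)
From HB Require Import structures.
From mathcomp Require Import all_boot all_order all_algebra.
From mathcomp Require Import all_classical all_reals all_analysis.
Set Implicit Arguments.
Unset Strict Implicit.
Unset Printing Implicit Defensive.
Import Order.TTheory GRing.Theory Num.Theory.
Import numFieldNormedType.Exports.
Local Open Scope classical_set_scope.
Local Open Scope ring_scope.

(* The library norm `|x| on 'rV[R]_d is the sup norm. It induces the Euclidean
   topology and the same differentials, so the library notions of limit,
   semicontinuity and differentiability are used as they are; wherever a norm
   occurs quantitatively it is [enorm]. *)
Definition dot (R : realType) (d : nat) (u v : 'rV[R]_d) : R :=
  \sum_(i < d) u 0 i * v 0 i.

Definition enorm (R : realType) (d : nat) (u : 'rV[R]_d) : R :=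
  Num.sqrt (dot u u).

(* dist(x, A), with value +oo when A is empty. *)
Definition dist_to (R : realType) (d : nat) (x : 'rV[R]_d) (A : set 'rV[R]_d)
    : \bar R :=
  ereal_inf [set (enorm (x - y))%:E | y in A].

(* Coordinates of the vector representing the differential; see [dot_grad]. *)
Definition grad (R : realType) (d : nat) (g : 'rV[R]_d -> R) (x : 'rV[R]_d)
    : 'rV[R]_d :=
  \row_i 'd g x (delta_mx 0 i).

Lemma dot_grad (R : realType) (d : nat) (g : 'rV[R]_d -> R) (x v : 'rV[R]_d) :
  dot (grad g x) v = 'd g x v.
Proof.
rewrite [in RHS](row_sum_delta v) linear_sum; apply: eq_bigr => i _.
by rewrite mxE linearZ /= mulrC.
Qed.

Definition diff_lipschitz_grad (R : realType) (d : nat) (L : R)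
    (g : 'rV[R]_d -> R) : Prop :=
  (forall x, differentiable g x) /\
  (forall x y, enorm (grad g x - grad g y) <= L * enorm (x - y)).

Definition strongly_convex (R : realType) (d : nat) (sigma : R)
    (F : 'rV[R]_d -> R) : Prop :=
  convex_function (E := 'rV[R]_d) [set: 'rV[R]_d]
    (fun x => F x - sigma / 2 * enorm x ^+ 2).

Definition bregman (R : realType) (d : nat) (F : 'rV[R]_d -> R)
    (x y : 'rV[R]_d) : R :=
  F x - F y - dot (grad F y) (x - y).

(* Functions into (-oo, +oo] are functions into \bar R avoiding -oo; this is
   part of [proper_fun]. *)
Definition proper_fun (R : realType) (d : nat) (h : 'rV[R]_d -> \bar R) : Prop :=
  (forall x, -oo < h x)%E /\ (exists x, h x < +oo)%E.

Definition bounded_below (R : realType) (d : nat) (h : 'rV[R]_d -> \bar R)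
    : Prop :=
  exists a : R, forall x, (a%:E <= h x)%E.

Definition coercive (R : realType) (d : nat) (h : 'rV[R]_d -> \bar R) : Prop :=
  forall A : R, exists r : R, forall x, r < enorm x -> (A%:E < h x)%E.

Definition dom (R : realType) (d : nat) (h : 'rV[R]_d -> \bar R)
    : set 'rV[R]_d :=
  [set x | (h x < +oo)%E].

Definition argmin (R : realType) (d : nat) (h : 'rV[R]_d -> \bar R)
    : set 'rV[R]_d :=
  [set u | forall v, (h u <= h v)%E].

Definition frechet_subdiff (R : realType) (d : nat) (h : 'rV[R]_d -> \bar R)
    (x : 'rV[R]_d) : set 'rV[R]_d :=
  [set v | dom h x /\
    (0 <= limf_einf (fun y => (h y - h x - (dot v (y - x))%:E)
                              * ((enorm (y - x))^-1)%:E) (x^'))%E].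

Definition limiting_subdiff (R : realType) (d : nat) (h : 'rV[R]_d -> \bar R)
    (x : 'rV[R]_d) : set 'rV[R]_d :=
  [set v | dom h x /\
    exists (xs vs : nat -> 'rV[R]_d),
      [/\ xs n @[n --> \oo] --> x,
          h (xs n) @[n --> \oo] --> h x,
          forall n, frechet_subdiff h (xs n) (vs n)
        & vs n @[n --> \oo] --> v]].

Definition crit (R : realType) (d : nat) (h : 'rV[R]_d -> \bar R)
    : set 'rV[R]_d :=
  [set x | limiting_subdiff h x 0].

Definition dom_subdiff (R : realType) (d : nat) (h : 'rV[R]_d -> \bar R)
    : set 'rV[R]_d :=
  [set x | limiting_subdiff h x !=set0].

(* The class Theta_eta. A function on [0, eta) is encoded by a total function
   of which only the values on [0, eta) are constrained. *)
Definition desingularizing (R : realType) (eta : \bar R) (phi : R -> R)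
    : Prop :=
  let I := [set s : R | 0 <= s /\ (s%:E < eta)%E] in
  let J := [set s : R | 0 < s /\ (s%:E < eta)%E] in
  [/\ [/\ convex_function (E := R^o) I (fun s => - phi s),
          {within I, continuous phi},
          (forall s, I s -> 0 <= phi s)
        & phi 0 = 0],
      (forall s, J s -> derivable phi s 1),
      {within J, continuous (derive1 phi)}
    & forall s, J s -> 0 < derive1 phi s].

Definition KL_at (R : realType) (d : nat) (h : 'rV[R]_d -> \bar R)
    (xbar : 'rV[R]_d) : Prop :=
  exists (eta : \bar R) (U : set 'rV[R]_d) (phi : R -> R),
    [/\ (0 < eta)%E, nbhs xbar U, desingularizing eta phi
      & forall x, U x -> (h xbar < h x)%E -> (h x < h xbar + eta)%E ->
          (1 <= (derive1 phi (fine (h x - h xbar)))%:E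
                * dist_to 0 (limiting_subdiff h x))%E].

Definition KL_function (R : realType) (d : nat) (h : 'rV[R]_d -> \bar R)
    : Prop :=
  forall xbar, dom_subdiff h xbar -> KL_at h xbar.

(* R^m x R^m, with its Euclidean structure, is 'rV[R]_(m + m). *)
Definition on_pairs (R : realType) (m : nat)
    (H : 'rV[R]_m -> 'rV[R]_m -> \bar R) : 'rV[R]_(m + m) -> \bar R :=
  fun z => H (lsubmx z) (rsubmx z).

Definition generated_by_algorithm (R : realType) (m : nat)
    (f : 'rV[R]_m -> \bar R) (g F : 'rV[R]_m -> R) (alo ahi beta : R)
    (x : nat -> 'rV[R]_m) : Prop :=
  exists alphas betas : nat -> R,
    (forall n, (1 <= n)%N ->
       alo <= alphas n <= ahi /\ 0 <= betas n <= beta) /\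
    (forall n, (1 <= n)%N ->
       argmin (fun u =>
         (bregman F u (x n) + alphas n * dot u (grad g (x n))
          + betas n * dot u (x n.-1 - x n))%:E
         + (alphas n)%:E * f u)%E
       (x n.+1)).

(* Main.v *)
(** Let [y n = x (n+1)] and [D n = |y (n+1) - y n|]. Comparing the minimizer
    [x (n+1)] with [x n] and using the quadratic bounds for [g] and [F] gives
    [H (x (n+1), x n) + (M1 - M2) |x (n+1) - x n|^2 <= H (x n, x (n-1))], and the
    optimality of [x (n+1)] against all points yields explicit proximal
    subgradients of [f + g] and [H] there, of size [O(|x (n+1) - x n| +
    |x n - x (n-1)|)]. Coercivity bounds the iterates; at a cluster point of the
    pairs, lower semicontinuity and the uniform quadratic constant in the
    proximal inequality give convergence of the values of [H] along the
    subsequence, and that the point is critical. The KL inequality at this one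
    cluster point then gives [2 D (n+2) <= (D (n+1) + D n) / 2 + 2 c (psi (n+1) -
    psi (n+2))] with [psi n = phi (H_n - H_lim)] as long as the iterates stay near
    it; a Lyapunov function shows that they do, and that the lengths are
    summable. *)

Require Import Defs.
From HB Require Import structures.
From mathcomp Require Import all_boot all_order all_algebra.
From mathcomp Require Import all_classical all_reals all_analysis.
From mathcomp Require Import ring lra.
Set Implicit Arguments.
Unset Strict Implicit.
Unset Printing Implicit Defensive.
Import Order.TTheory GRing.Theory Num.Theory.
Import numFieldNormedType.Exports.
Local Open Scope classical_set_scope.
Local Open Scope ring_scope.

(** * The Euclidean norm *)

Lemma dotC (R : realType) (d : nat) (u v : 'rV[R]_d) : dot u v = dot v u.
Proof. by apply: eq_bigr => i _; rewrite mulrC. Qed.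

Lemma dotDl (R : realType) (d : nat) (u v w : 'rV[R]_d) :
  dot (u + v) w = dot u w + dot v w.
Proof. by rewrite -big_split; apply: eq_bigr => i _; rewrite mxE mulrDl. Qed.

Lemma dotZl (R : realType) (d : nat) (a : R) (u w : 'rV[R]_d) :
  dot (a *: u) w = a * dot u w.
Proof. by rewrite mulr_sumr; apply: eq_bigr => i _; rewrite mxE mulrA. Qed.

Lemma dotNl (R : realType) (d : nat) (u w : 'rV[R]_d) : dot (- u) w = - dot u w.
Proof. by rewrite -scaleN1r dotZl mulN1r. Qed.

Lemma dotBl (R : realType) (d : nat) (u v w : 'rV[R]_d) :
  dot (u - v) w = dot u w - dot v w.
Proof. by rewrite dotDl dotNl. Qed.

Lemma dotDr (R : realType) (d : nat) (u v w : 'rV[R]_d) :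
  dot u (v + w) = dot u v + dot u w.
Proof. by rewrite ![dot u _]dotC dotDl. Qed.

Lemma dotZr (R : realType) (d : nat) (a : R) (u w : 'rV[R]_d) :
  dot u (a *: w) = a * dot u w.
Proof. by rewrite ![dot u _]dotC dotZl. Qed.

Lemma dotNr (R : realType) (d : nat) (u w : 'rV[R]_d) : dot u (- w) = - dot u w.
Proof. by rewrite ![dot u _]dotC dotNl. Qed.

Lemma dotBr (R : realType) (d : nat) (u v w : 'rV[R]_d) :
  dot w (u - v) = dot w u - dot w v.
Proof. by rewrite dotDr dotNr. Qed.

Lemma dot0l (R : realType) (d : nat) (w : 'rV[R]_d) : dot 0 w = 0.
Proof. by rewrite -(scale0r 0) dotZl mul0r. Qed.

Definition dotE := (dotDl, dotDr, dotNl, dotNr, dotZl, dotZr).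

Lemma dot_ge0 (R : realType) (d : nat) (u : 'rV[R]_d) : 0 <= dot u u.
Proof. by apply: sumr_ge0 => i _; rewrite -expr2 sqr_ge0. Qed.

Lemma enorm_ge0 (R : realType) (d : nat) (u : 'rV[R]_d) : 0 <= enorm u.
Proof. exact: sqrtr_ge0. Qed.

Lemma enorm_sqr (R : realType) (d : nat) (u : 'rV[R]_d) : enorm u ^+ 2 = dot u u.
Proof. by rewrite sqr_sqrtr // dot_ge0. Qed.

Lemma enorm_eq0 (R : realType) (d : nat) (u : 'rV[R]_d) : enorm u = 0 -> u = 0.
Proof.
move=> u0; have: dot u u = 0 by rewrite -enorm_sqr u0 expr0n.
move=> /eqP; rewrite psumr_eq0; last by move=> i _; rewrite -expr2 sqr_ge0.
move=> /allP uE; apply/rowP => i; rewrite mxE; apply/eqP.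
by have := uE i (mem_index_enum i); rewrite mulf_eq0 orbb.
Qed.

Lemma enorm0 (R : realType) (d : nat) : enorm (0 : 'rV[R]_d) = 0.
Proof. by rewrite /enorm dot0l sqrtr0. Qed.

Lemma enormZ (R : realType) (d : nat) (a : R) (u : 'rV[R]_d) :
  enorm (a *: u) = `|a| * enorm u.
Proof.
by rewrite /enorm !dotE mulrA -expr2 sqrtrM ?sqr_ge0 // sqrtr_sqr.
Qed.

Lemma enormN (R : realType) (d : nat) (u : 'rV[R]_d) : enorm (- u) = enorm u.
Proof. by rewrite -scaleN1r enormZ normrN1 mul1r. Qed.

Lemma enormB (R : realType) (d : nat) (u v : 'rV[R]_d) :
  enorm (u - v) = enorm (v - u).
Proof. by rewrite -enormN opprB. Qed.

Lemma young_dot (R : realType) (d : nat) (mu : R) (u v : 'rV[R]_d) : 0 < mu ->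
  dot u v <= mu / 2 * enorm u ^+ 2 + enorm v ^+ 2 / (2 * mu).
Proof.
move=> mu0; rewrite !enorm_sqr.
have := dot_ge0 (mu *: u - v); rewrite !dotE [dot v u]dotC => h.
rewrite -subr_ge0.
have -> : mu / 2 * dot u u + dot v v / (2 * mu) - dot u v =
  (mu * (mu * dot u u) - mu * dot u v + - (mu * dot u v - dot v v)) / (2 * mu).
  by field; rewrite gt_eqF.
by rewrite divr_ge0 //; [lra|rewrite mulr_ge0 // ltW].
Qed.

(** Young's inequality at its optimal weight [enorm v / enorm u]; zero vectors are treated apart. *)
Lemma dot_le_enorm (R : realType) (d : nat) (u v : 'rV[R]_d) :
  dot u v <= enorm u * enorm v.
Proof.
have [/enorm_eq0 ->|u0] := eqVneq (enorm u) 0; first by rewrite dot0l enorm0 mul0r.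
have [/enorm_eq0 ->|v0] := eqVneq (enorm v) 0.
  by rewrite dotC dot0l enorm0 mulr0.
have u_gt0 : 0 < enorm u by rewrite lt_def u0 enorm_ge0.
have v_gt0 : 0 < enorm v by rewrite lt_def v0 enorm_ge0.
apply: le_trans (young_dot u v (divr_gt0 v_gt0 u_gt0)) _.
by rewrite le_eqVlt; apply/orP; left; apply/eqP; field; rewrite u0.
Qed.

Lemma dotB_le_enorm (R : realType) (d : nat) (u v w : 'rV[R]_d) :
  dot u w - dot v w <= enorm (u - v) * enorm w.
Proof. by rewrite -dotBl dot_le_enorm. Qed.

Lemma ler_enormD (R : realType) (d : nat) (u v : 'rV[R]_d) :
  enorm (u + v) <= enorm u + enorm v.
Proof.
rewrite -(@ler_pXn2r _ 2) ?nnegrE ?addr_ge0 ?enorm_ge0 //.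
rewrite enorm_sqr sqrrD !enorm_sqr !dotE [dot v u]dotC.
by have := dot_le_enorm u v; lra.
Qed.

Lemma enorm_dist_triangle (R : realType) (d : nat) (v u w : 'rV[R]_d) :
  enorm (u - w) <= enorm (u - v) + enorm (v - w).
Proof. by apply: le_trans (ler_enormD _ _); rewrite addrA subrK. Qed.

Lemma normr_le_enorm (R : realType) (d : nat) (u : 'rV[R]_d) : `|u| <= enorm u.
Proof.
rewrite [leLHS]mx_normrE; apply/bigmax_leP; split=> [|[i j] _ /=].
  exact: enorm_ge0.
rewrite [i]ord1 -sqrtr_sqr ler_sqrt ?dot_ge0 // /dot (bigD1 j) //= -expr2.
by rewrite lerDl; apply: sumr_ge0 => k _; rewrite -expr2 sqr_ge0.
Qed.

(** The crude factor [d.+1] is positive even for [d = 0], so [nbhs_enorm] can divide by it. *)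
Lemma enorm_le_normr (R : realType) (d : nat) (u : 'rV[R]_d) :
  enorm u <= d.+1%:R * `|u|.
Proof.
rewrite -(@ler_pXn2r _ 2) ?nnegrE ?mulr_ge0 ?enorm_ge0 ?ler0n //.
rewrite enorm_sqr /dot exprMn.
apply: (@le_trans _ _ (\sum_(i < d) `|u| ^+ 2)).
  apply: ler_sum => i _; rewrite -expr2 -real_normK ?num_real //.
  rewrite ler_pXn2r ?nnegrE // [leRHS]mx_normrE.
  by apply/bigmax_geP; right; exists (0, i).
rewrite sumr_const card_ord -[leLHS]mulr_natl ler_wpM2r ?sqr_ge0 //.
by rewrite -natrX ler_nat; apply: leq_trans (leqnSn _) _; rewrite leq_pmulr.
Qed.

Lemma nbhs_enorm (R : realType) (d : nat) (x : 'rV[R]_d) (U : set 'rV[R]_d) :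
  nbhs x U <-> exists2 e : R, 0 < e & forall y, enorm (y - x) < e -> U y.
Proof.
split=> [/nbhs_ballP[e e0 eU]|[e e0 eU]].
  exists e => // y yx; apply: eU; rewrite -ball_normE /=.
  by rewrite distrC (le_lt_trans (normr_le_enorm _)).
apply/nbhs_ballP; exists (e / d.+1%:R); first by rewrite /= divr_gt0.
move=> y; rewrite -ball_normE /= distrC => yx; apply: eU.
apply: le_lt_trans (enorm_le_normr _) _.
by rewrite mulrC -ltr_pdivlMr.
Qed.

Lemma cvg_enorm (R : realType) (d : nat) (xs : nat -> 'rV[R]_d) (x : 'rV[R]_d) :
  xs n @[n --> \oo] --> x <->
  forall e : R, 0 < e -> exists N, forall n, (N <= n)%N -> enorm (xs n - x) < e.
Proof.
split=> [xsx e e0|h].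
  have : nbhs x [set y | enorm (y - x) < e] by apply/nbhs_enorm; exists e.
  by move=> /xsx[N _ Nh]; exists N => n Nn; exact: Nh.
move=> U /nbhs_enorm[e e0 eU].
by have [N Nh] := h e e0; exists N => // n Nn; apply: eU; exact: Nh.
Qed.

(** Bolzano-Weierstrass in cluster-point form, from the compactness of a closed sup-norm ball. *)
Lemma frequently_near (R : realType) (d : nat) (B : R) (xs : nat -> 'rV[R]_d) :
  (forall n, enorm (xs n) <= B) -> exists x, forall e : R, 0 < e ->
  forall N, exists2 n, (N <= n)%N & enorm (xs n - x) < e.
Proof.
move=> xsB; pose A := [set u : 'rV[R]_d | `|u| <= B].
have cA : compact A.
  apply: bounded_closed_compact.
    by exists B; split=> [|M BM u Au]; [exact: num_real|exact: le_trans Au (ltW BM)].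
  have -> : A = (fun u : 'rV[R]_d => `|u|) @^-1` [set r : R | r <= B] by [].
  by apply: closed_comp; [move=> u _; exact: norm_continuous|exact: closed_le].
have FA : (xs n @[n --> \oo]) A.
  by exists 0%N => // n _; exact: le_trans (normr_le_enorm _) (xsB n).
have [x [_ xcl]] := cA _ _ FA.
exists x => e e0 N.
have [||y [[n Nn <-] yx]] := xcl (xs @` [set n | (N <= n)%N]) [set y | enorm (y - x) < e].
- by exists N => // n Nn; exists n.
- by apply/nbhs_enorm; exists e.
- by exists n.
Qed.

(** * First-order inequalities *)

Lemma dot_grad_derive (R : realType) (d : nat) (g : 'rV[R]_d -> R)
    (x v : 'rV[R]_d) : differentiable g x -> dot (grad g x) v = 'D_v g x.
Proof. by move=> dg; rewrite dot_grad deriveE. Qed.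

(** The difference quotient is at most [K + t * M], and [t] tends to 0. The slack [M] accommodates
    strong convexity; plain convexity takes [M = 0]. *)
Lemma derive_le_chord (R : realType) (V : normedModType R) (f : V -> R)
    (x v : V) (K M : R) : derivable f x v ->
  (forall t : R, 0 < t -> t < 1 -> f (t *: v + x) <= f x + t * K + t ^+ 2 * M) ->
  'D_v f x <= K.
Proof.
move=> df fK; rewrite leNgt; apply/negP => KD.
pose e := 'D_v f x - K; have e0 : 0 < e by rewrite subr_gt0.
have := df => /cvg_ex[l fl].
have lE : 'D_v f x = l by apply: cvg_lim.
have /fl : nbhs l [set y : R | K + e / 2 < y].
  exists (e / 2) => /=; first by rewrite divr_gt0.
  by move=> y /=; rewrite ltr_norml -lE => /andP[_]; rewrite /e; lra.
rewrite nbhs_simpl /= => -[r /= r0 rh].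
(* Within the radius [r], below 1, and so small that the slack [t * M] costs at most half of the gap
   [e]. *)
pose t := Num.min (r / 2) (Num.min (1 / 2) (e / (2 * (`|M| + 1)))).
have M1 : 0 < `|M| + 1 by rewrite ltr_wpDl.
have t0 : 0 < t by rewrite !lt_min !divr_gt0 // mulr_gt0.
have tr : t < r.
  by apply: (@le_lt_trans _ _ (r / 2)); [rewrite ge_min lexx|lra].
have t1 : t < 1.
  by apply: (@le_lt_trans _ _ (1 / 2)); [rewrite !ge_min lexx orbT|lra].
have tM : t * (`|M| + 1) <= e / 2.
  rewrite -ler_pdivlMr // -mulrA -invfM; first by rewrite !ge_min lexx !orbT.
have := rh t; rewrite /= sub0r normrN gtr0_norm // => /(_ tr).
rewrite gt_eqF // => /(_ isT); rewrite /GRing.scale /= => h.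
have := fK t t0 t1 => h2.
have h3 : t^-1 * (f (t *: v + x) - f x) <= K + t * M.
  by rewrite ler_pdivrMl // mulrDr; lra.
have : t * M <= t * (`|M| + 1).
  rewrite ler_pM2l //; apply: le_trans (ler_norm M) _; rewrite lerDl //.
lra.
Qed.

Lemma convex_function_segment (R : realType) (E : lmodType R) (D : set E)
    (f : E -> R) (x y : E) (t : R) : convex_function D f -> D x -> D y ->
  0 <= t <= 1 -> f (t *: (y - x) + x) <= t * f y + (1 - t) * f x.
Proof.
move=> cf Dx Dy t01.
have -> : t *: (y - x) + x = t *: y + (1 - t) *: x.
  by rewrite scalerBr scalerBl scale1r addrAC -addrA addrC.
have := cf (@Itv01 R t (proj1 (andP t01)) (proj2 (andP t01))) y x.
by rewrite !inE => /(_ Dy Dx).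
Qed.

(** Strong convexity improves the chord bound by [sigma / 2 * t * (1 - t) * enorm (x - y) ^+ 2]; the
    part linear in [t] survives in the derivative. *)
Lemma bregman_ge (R : realType) (d : nat) (sigma : R) (F : 'rV[R]_d -> R)
    (x y : 'rV[R]_d) : differentiable F y -> strongly_convex sigma F ->
  sigma / 2 * enorm (x - y) ^+ 2 <= bregman F x y.
Proof.
move=> dF cF; rewrite /bregman.
suff : dot (grad F y) (x - y) <= F x - F y - sigma / 2 * enorm (x - y) ^+ 2 by lra.
rewrite dot_grad_derive //.
apply: (@derive_le_chord _ _ _ _ _ _ (sigma / 2 * enorm (x - y) ^+ 2)).
  exact: diff_derivable.
move=> t t0 t1.
have := @convex_function_segment R _ _ _ y x t cF I I; rewrite (ltW t0) (ltW t1).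
move=> /(_ isT); rewrite !enorm_sqr !dotE [dot x y]dotC.
by lra.
Qed.

Lemma concave_tangent (R : realType) (eta : \bar R) (phi : R -> R) (s t : R) :
  desingularizing eta phi -> 0 < s -> (s%:E < eta)%E -> 0 <= t ->
  (t%:E < eta)%E -> derive1 phi s * (s - t) <= phi s - phi t.
Proof.
move=> [[cphi _ _ _] dphi _ _] s0 se t0 te.
have ds : derivable phi s 1 by apply: dphi.
have /derivable1_diffP dfs : derivable (- phi) s 1 by exact: derivableN.
suff : 'D_(t - s) (- phi) s <= phi s - phi t.
  rewrite deriveE // -[t - s]mulr1 [(t - s) * 1]/((t - s) *: (1 : R^o)) linearZ.
  by rewrite -deriveE // deriveN // -derive1E /= /GRing.scale /= mulrN -mulNr opprB mulrC.
apply: (@derive_le_chord R R^o (- phi) s (t - s) (phi s - phi t) 0).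
  exact: diff_derivable.
move=> l l0 l1; rewrite mulr0 addr0.
have := @convex_function_segment R R^o _ _ s t l cphi.
move=> /(_ (conj (ltW s0) se) (conj t0 te)); rewrite (ltW l0) (ltW l1) => /(_ isT).
move=> /= h; apply: le_trans h _.
by have -> : (- phi) s = - phi s by []; lra.
Qed.

(** The descent lemma, with the mean value theorem in place of an integral: [f] is [g] on the
    segment minus its tangent and minus [t ^+ 2 * K], and the Lipschitz bound makes its derivative
    nonpositive on (0, 1). *)
Lemma gradient_quadratic_bound (R : realType) (d : nat) (L : R)
    (g : 'rV[R]_d -> R) (x y : 'rV[R]_d) : diff_lipschitz_grad L g ->
  g y <= g x + dot (grad g x) (y - x) + L / 2 * enorm (y - x) ^+ 2.
Proof.
move=> [dg Lg]; pose v := y - x.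
pose K := L / 2 * enorm v ^+ 2.
pose psi (t : R) := g (t *: v + x).
have dpsi (t : R) : is_derive t 1 psi (dot (grad g (t *: v + x)) v).
  have dv := @diff_derivable _ _ _ g (t *: v + x) v (dg _).
  have E : (fun h : R => h^-1 *: ((psi \o shift t) (h *: (1 : R)) - psi t)) =
      (fun h : R => h^-1 *: ((g \o shift (t *: v + x)) (h *: v) - g (t *: v + x))).
    apply/funext => h; congr (_ *: (g _ - _)).
    by rewrite /= (mulr1 h : h *: (1 : R) = h) scalerDl addrA.
  apply: DeriveDef; first by rewrite /derivable E.
  by rewrite dot_grad_derive // /derive E.
pose A := dot (grad g x) v.
pose f (t : R) := psi t - t * A - t ^+ 2 * K.
have df (t : R) : is_derive t 1 f (dot (grad g (t *: v + x)) v - A - 2 * t * K).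
  have -> : f = psi - (A \*: id) - (K \*: (id : R -> R) ^+ 2).
    by apply/funext => u /=; rewrite /f !fctE /= /GRing.scale /=; ring.
  by apply: is_derive_eq; rewrite /GRing.scale /=; ring.
have [|c] := @MVT R f _ 0 1 ltr01 (fun t _ => df t).
  apply: derivable_within_continuous => t _; exact: ex_derive.
rewrite in_itv /= => /andP[c0 c1]; rewrite subr0 mulr1 => fE.
have := Lg (c *: v + x) x; rewrite addrK enormZ gtr0_norm // => Lc.
have dl := dotB_le_enorm (grad g (c *: v + x)) (grad g x) v.
have dl2 : dot (grad g (c *: v + x)) v - A <= 2 * c * K.
  apply: le_trans dl _; apply: le_trans (ler_wpM2r (enorm_ge0 _) Lc) _.
  by rewrite /K; lra.
have : f 1 - f 0 <= 0 by rewrite fE subr_le0.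
rewrite subr_le0 /f /psi scale1r scale0r add0r subrK.
rewrite !lerBlDr expr1n expr0n /= !mul0r !mul1r !subr0.
by rewrite -addrA [K + A]addrC addrA.
Qed.

Lemma gradient_quadratic_bound_below (R : realType) (d : nat) (L : R)
    (g : 'rV[R]_d -> R) (x y : 'rV[R]_d) : diff_lipschitz_grad L g ->
  g x + dot (grad g x) (y - x) - L / 2 * enorm (y - x) ^+ 2 <= g y.
Proof.
move=> [dg Lg].
have gN u : grad (- g) u = - grad g u.
  by apply/rowP => i; rewrite !mxE diffN.
have dN : diff_lipschitz_grad L (- g).
  by split=> [u|u w]; [exact: differentiableN|rewrite !gN -opprD enormN].
have := gradient_quadratic_bound x y dN.
have -> : (- g) y = - g y by [].
have -> : (- g) x = - g x by [].
by rewrite gN dotNl; move: (dot _ _) => A; lra.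
Qed.

(** * Proximal subgradients *)

(* The quadratic constant and the validity for all [u] make these subgradients
   stable under limits, which Frechet subgradients are not. *)
Definition proximal_subgradient (R : realType) (d : nat) (C : R)
    (h : 'rV[R]_d -> \bar R) (p v : 'rV[R]_d) : Prop :=
  forall u, (h p + (dot v (u - p) - C * enorm (u - p) ^+ 2)%:E <= h u)%E.

(** Divided by [enorm (y - p)], the quadratic error becomes linear in that distance, hence at most
    [e] on the punctured ball [V]. *)
Lemma proximal_frechet (R : realType) (d : nat) (C r : R)
    (h : 'rV[R]_d -> \bar R) (p v : 'rV[R]_d) : h p = r%:E ->
  proximal_subgradient C h p v -> frechet_subdiff h p v.
Proof.
move=> hp hv; split; first by rewrite /dom /= hp ltry.
rewrite limf_einfE; apply/lee_addgt0Pr => e e0; rewrite -leeBlDr // sub0e.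
pose V := [set y | y <> p /\ enorm (y - p) < e / (`|C| + 1)].
have C0 : 0 < `|C| + 1 by rewrite ltr_wpDl.
have VF : p^' V.
  have : nbhs p [set y | enorm (y - p) < e / (`|C| + 1)].
    by apply/nbhs_enorm; exists (e / (`|C| + 1)) => //; rewrite divr_gt0.
  by rewrite /dnbhs; apply: filterS => y yp /eqP yNp; split.
apply: (@le_trans _ _ (ereal_inf [set ((h y - h p - (dot v (y - p))%:E)
            * ((enorm (y - p))^-1)%:E)%E | y in V])); last first.
  by apply: ereal_sup_ubound; exists V.
apply: le_ereal_inf_tmp => _ [y [yNp yp] <-].
have n0 : 0 < enorm (y - p).
  rewrite lt_def enorm_ge0 andbT; apply/eqP => /enorm_eq0 /eqP.
  by rewrite subr_eq0 => /eqP.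
have := hv y; rewrite hp; case: (h y) => [s|_|//].
  rewrite -!EFinD -!EFinM !lee_fin => hs.
  rewrite ler_pdivlMr //.
  have : `|C| * enorm (y - p) <= e.
    apply: (@le_trans _ _ ((`|C| + 1) * enorm (y - p))).
      by rewrite ler_wpM2r ?enorm_ge0 // lerDl.
    by rewrite mulrC -ler_pdivlMr // ltW.
  move=> /(ler_wpM2r (ltW n0)); rewrite -mulrA -expr2.
  have := ler_wpM2r (sqr_ge0 (enorm (y - p))) (ler_norm C).
  by move: hs; move: (dot _ _) (enorm _ ^+ 2) => A E; lra.
by rewrite /= gt0_mulye ?lte_fin ?invr_gt0 // leey.
Qed.

Lemma frechet_limiting (R : realType) (d : nat) (h : 'rV[R]_d -> \bar R)
    (x v : 'rV[R]_d) : frechet_subdiff h x v -> limiting_subdiff h x v.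
Proof.
move=> xv; split; first by case: xv.
by exists (fun=> x), (fun=> v); split => //; exact: cvg_cst.
Qed.

(** Lower semicontinuity and the bound [B] make [h x] finite and control the values from below. The
    proximal inequality tested at [u = x] controls them from above, which gives the convergence of
    values that the limiting subdifferential demands. *)
Lemma limiting_subdiff_of_proximal (R : realType) (d : nat) (C B : R)
    (h : 'rV[R]_d -> \bar R) (xs vs : nat -> 'rV[R]_d) (x : 'rV[R]_d)
    (r : nat -> R) :
  lower_semicontinuous h -> (-oo < h x)%E ->
  (forall n, h (xs n) = (r n)%:E) -> (forall n, r n <= B) ->
  (forall n, proximal_subgradient C h (xs n) (vs n)) ->
  xs n @[n --> \oo] --> x -> vs n @[n --> \oo] --> (0 : 'rV[R]_d) ->
  limiting_subdiff h x 0 /\ exists2 l, h x = l%:E & r n @[n --> \oo] --> l.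
Proof.
move=> lsc hx hxs rB prox xsx vs0.
have low (c : R) : (c%:E < h x)%E -> \forall n \near \oo, c < r n.
  move=> /lsc[V Vx Vh]; have [N _ Nh] := xsx _ Vx; exists N => // n /Nh /Vh /=.
  by rewrite hxs lte_fin.
have [l hl] : exists l, h x = l%:E.
  case: (h x) hx low => [l _ _|_ low|//]; first by exists l.
  have [N _ Nh] := low B (ltry _).
  by have := Nh N (leqnn N); rewrite /= ltNge rB.
have rl : r n @[n --> \oo] --> l.
  apply/cvgrPdist_lt => e e0.
  have C0 : 0 < `|C| + 1 by rewrite ltr_wpDl.
  pose t := Num.min 1 (e / 2 / (`|C| + 1)).
  have t0 : 0 < t by rewrite lt_min ltr01 !divr_gt0.
  have t1 : t <= 1 by rewrite ge_min lexx.
  have tC : (`|C| + 1) * t <= e / 2.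
    by rewrite mulrC -ler_pdivlMr // ge_min lexx orbT.
  have [N1 N1h] := (cvg_enorm _ _).1 xsx t t0.
  have [N2 N2h] := (cvg_enorm _ _).1 vs0 1 ltr01.
  have [N3 _ N3h] : \forall n \near \oo, l - e < r n.
    by apply: low; rewrite hl lte_fin; lra.
  exists (maxn N1 (maxn N2 N3)) => // n; rewrite /= !geq_max => /and3P[n1 n2 n3].
  have := N3h _ n3; have := N1h _ n1; have := N2h _ n2; rewrite /= subr0 enormB.
  have := prox n x; rewrite hxs hl -EFinD lee_fin => hp v1 xt rn.
  rewrite ltr_norml; apply/andP; split; last lra.
  have h1 : - dot (vs n) (x - xs n) <= t.
    rewrite -dotNl; apply: le_trans (dot_le_enorm _ _) _; rewrite enormN -[leRHS]mul1r.
    by rewrite ler_pM ?enorm_ge0 // ltW.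
  have h2 : C * enorm (x - xs n) ^+ 2 <= `|C| * t.
    apply: (@le_trans _ _ (`|C| * enorm (x - xs n) ^+ 2)).
      by rewrite ler_wpM2r ?sqr_ge0 // ler_norm.
    apply: ler_wpM2l => //; apply: (@le_trans _ _ (t ^+ 2)).
      by rewrite ler_pXn2r ?nnegrE ?enorm_ge0 // ltW.
    by rewrite expr2 ler_piMl // ltW.
  by move: hp h1 h2; move: (dot _ _) (C * _) => A E; lra.
split; last by exists l.
split; first by rewrite /dom /= hl ltry.
exists xs, vs; split => //.
  rewrite hl; apply: cvg_EFin; first by apply: nearW => n; rewrite hxs.
  by under eq_fun do rewrite /= hxs.
by move=> n; apply: proximal_frechet (prox n).
Qed.

(** * The Kurdyka-Lojasiewicz argument *)

(** Weighted arithmetic-geometric mean inequality. The weight 1/4 puts a total factor 1/2 on the two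
    earlier lengths, small enough to be absorbed in [trapped_near]. *)
Lemma le_of_sqr_le_mul (R : realFieldType) (t x y : R) : 0 <= x -> 0 <= y ->
  t ^+ 2 <= x * y -> t <= x / 4 + y.
Proof.
move=> x0 y0 txy; rewrite leNgt; apply/negP => h.
have h0 : 0 <= x / 4 + y by rewrite addr_ge0 // divr_ge0.
have : (x / 4 + y) ^+ 2 < t ^+ 2 by rewrite ltr_pXn2r // nnegrE // (le_trans h0) // ltW.
have := sqr_ge0 (x / 4 - y); nra.
Qed.

(** Descent, the KL inequality and concavity of [phi] multiply to [D2 ^+ 2 <= (D1 + D0) * (b / a *
    (phi s1 - phi s2))]; then take the square root. *)
Lemma desingularized_step (R : realType) (eta : \bar R) (phi : R -> R)
    (a b s1 s2 D0 D1 D2 : R) : desingularizing eta phi -> 0 < a -> 0 < b ->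
  0 <= D0 -> 0 <= D1 -> 0 <= s2 -> (s1%:E < eta)%E -> a * D2 ^+ 2 <= s1 - s2 ->
  (0 < s1 -> 1 <= derive1 phi s1 * (b * (D1 + D0))) ->
  D2 <= (D1 + D0) / 4 + b / a * (phi s1 - phi s2).
Proof.
move=> dphi a0 b0 D00 D10 s20 s1e aD KL.
have s21 : s2 <= s1.
  by rewrite -subr_ge0; apply: le_trans aD; rewrite mulr_ge0 ?sqr_ge0 // ltW.
have D01 : 0 <= D1 + D0 by rewrite addr_ge0.
have s10 := le_trans s20 s21.
(* At [s1 = 0] the KL inequality is silent, but then [s2 = 0] and descent forces [D2 = 0]. *)
move: s10; rewrite le_eqVlt => /orP[/eqP s10|s10].
  have s20' : s2 = 0 by apply/eqP; rewrite eq_le s20 s10 s21.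
  have : D2 ^+ 2 <= 0.
    by rewrite -(pmulr_rle0 _ a0); apply: le_trans aD _; rewrite -s10 s20' subrr.
  rewrite -s10 s20' subrr mulr0 addr0 => D2le.
  have /eqP : D2 ^+ 2 = 0 by apply/eqP; rewrite eq_le D2le sqr_ge0.
  by rewrite sqrf_eq0 => /eqP ->; rewrite divr_ge0.
have [_ _ _ dpos] := dphi.
have p1 : 0 < derive1 phi s1 by apply: dpos.
have s2e : (s2%:E < eta)%E by apply: le_lt_trans s1e; rewrite lee_fin.
have tan := concave_tangent dphi s10 s1e s20 s2e.
have dphi0 : 0 <= phi s1 - phi s2.
  by apply: le_trans tan; rewrite mulr_ge0 ?subr_ge0 // ltW.
apply: le_of_sqr_le_mul => //; first by rewrite mulr_ge0 // divr_ge0 // ltW.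
have -> : (D1 + D0) * (b / a * (phi s1 - phi s2)) =
    b * (D1 + D0) * (phi s1 - phi s2) / a by field; rewrite gt_eqF.
rewrite ler_pdivlMr // mulrC.
have B0 : 0 <= b * (D1 + D0) by rewrite mulr_ge0 // ltW.
apply: le_trans (ler_wpM2l B0 tan).
apply: (@le_trans _ _ (1 * (s1 - s2))); first by rewrite mul1r.
rewrite [leRHS]mulrA; apply: ler_wpM2r; first by rewrite subr_ge0.
by rewrite mulrC; exact: KL.
Qed.

(* [V n] is a Lyapunov function: as long as the iterates stay near [p] it drops
   by at least the length [D n.+2] of the next step, so they never leave. *)
Lemma trapped_near (R : realType) (m : nat) (y : nat -> 'rV[R]_m)
    (p : 'rV[R]_m) (psi : nat -> R) (c rho : R) (N : nat) :
  let D n := enorm (y n.+1 - y n) in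
  0 <= c -> (forall n, (N <= n)%N -> 0 <= psi n.+1) ->
  (forall n, (N <= n)%N -> enorm (y n.+2 - p) < rho ->
     enorm (y n.+1 - p) < rho ->
     D n.+2 <= (D n.+1 + D n) / 4 + c * (psi n.+1 - psi n.+2)) ->
  enorm (y N.+1 - p) < rho ->
  D N.+1 + D N / 2 + 2 * c * psi N.+1 + enorm (y N.+2 - p) < rho ->
  forall k, enorm (y (N + k).+1 - p) < rho /\ \sum_(i < k) D (N + i).+2 <= rho.
Proof.
move=> D c0 psi0 step y1 y2.
pose V n := D n.+1 + D n / 2 + 2 * c * psi n.+1.
have V0 n : (N <= n)%N -> 0 <= V n.
  move=> Nn; rewrite /V !addr_ge0 ?divr_ge0 ?enorm_ge0 // !mulr_ge0 //.
  exact: psi0.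
(* The second clause also keeps the next iterate near [p], since [step] asks for two consecutive
   ones. *)
suff inv k : [/\ enorm (y (N + k).+1 - p) < rho,
    V (N + k)%N + enorm (y (N + k).+2 - p) < rho &
    V (N + k)%N + \sum_(i < k) D (N + i).+2 <= V N].
  move=> k; have [h1 _ h3] := inv k; split=> //.
  have := V0 _ (leq_addr k N); have := enorm_ge0 (y N.+2 - p).
  by move: y2 h3; rewrite -/(V N); lra.
elim: k => [|k [h1 h2 h3]].
  by rewrite addn0 big_ord0 addr0.
rewrite addnS big_ord_recr /=; set n := (N + k)%N in h1 h2 h3 *.
have Nn : (N <= n)%N by exact: leq_addr.
have y2' : enorm (y n.+2 - p) < rho by have := V0 _ Nn; lra.
have := step n Nn y2' h1; have := enorm_dist_triangle (y n.+2) (y n.+3) p.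
rewrite -/(D n.+2) => tri st.
(* Twice [st]: half of [D n.+1] and half of [D n] are spent, the other half of [D n.+1] passes to
   [V n.+1]. *)
have VS : V n.+1 + D n.+2 <= V n by rewrite /V; lra.
by split=> //; lra.
Qed.

(** * Block vectors in the product space *)

Lemma dot_submx (R : realType) (m n : nat) (u v : 'rV[R]_(m + n)) :
  dot u v = dot (lsubmx u) (lsubmx v) + dot (rsubmx u) (rsubmx v).
Proof.
by rewrite /dot big_split_ord /=; congr (_ + _); apply: eq_bigr => i _; rewrite !mxE.
Qed.

Lemma enorm_sqr_submx (R : realType) (m n : nat) (u : 'rV[R]_(m + n)) :
  enorm u ^+ 2 = enorm (lsubmx u) ^+ 2 + enorm (rsubmx u) ^+ 2.
Proof. by rewrite !enorm_sqr dot_submx. Qed.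

Lemma enorm_lsubmx_le (R : realType) (m n : nat) (u : 'rV[R]_(m + n)) :
  enorm (lsubmx u) <= enorm u.
Proof.
rewrite -(@ler_pXn2r _ 2) ?nnegrE ?enorm_ge0 // enorm_sqr_submx.
by rewrite lerDl sqr_ge0.
Qed.

Lemma enorm_rsubmx_le (R : realType) (m n : nat) (u : 'rV[R]_(m + n)) :
  enorm (rsubmx u) <= enorm u.
Proof.
rewrite -(@ler_pXn2r _ 2) ?nnegrE ?enorm_ge0 // enorm_sqr_submx.
by rewrite lerDr sqr_ge0.
Qed.

Lemma enorm_submx_le (R : realType) (m n : nat) (u : 'rV[R]_(m + n)) :
  enorm u <= enorm (lsubmx u) + enorm (rsubmx u).
Proof.
rewrite -(@ler_pXn2r _ 2) ?nnegrE ?addr_ge0 ?enorm_ge0 // enorm_sqr_submx sqrrD.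
rewrite [leRHS]addrAC lerDl mulrn_wge0 // mulr_ge0 //; exact: enorm_ge0.
Qed.

Lemma enorm_row_mxB_le (R : realType) (m n : nat) (u u' : 'rV[R]_m)
    (v v' : 'rV[R]_n) :
  enorm (row_mx u v - row_mx u' v') <= enorm (u - u') + enorm (v - v').
Proof.
rewrite opp_row_mx add_row_mx; apply: le_trans (enorm_submx_le _) _.
by rewrite row_mxKl row_mxKr.
Qed.

(** The abstract scheme: sufficient descent with rate [a], subgradients bounded by step lengths with
    constant [b], bounded iterates. It works on pairs because the decreasing quantity involves two
    consecutive iterates. *)
Lemma KL_descent_cvg (R : realType) (m : nat) (h : 'rV[R]_(m + m) -> \bar R)
    (y : nat -> 'rV[R]_m) (w : nat -> 'rV[R]_(m + m)) (r : nat -> R)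
    (a b B C : R) :
  let D n := enorm (y n.+1 - y n) in
  let z n := row_mx (y n.+1) (y n) in
  0 < a -> 0 < b -> lower_semicontinuous h -> (forall u, (-oo < h u)%E) ->
  KL_function h -> (forall n, h (z n) = (r n)%:E) ->
  (forall n, r n.+1 + a * D n.+1 ^+ 2 <= r n) ->
  (forall n, proximal_subgradient C h (z n.+1) (w n)) ->
  (forall n, enorm (w n) <= b * (D n.+1 + D n)) ->
  (forall n, enorm (y n) <= B) ->
  (exists p : 'rV[R]_m, y n @[n --> \oo] --> p) /\
  (exists S, forall n, \sum_(i < n) D i <= S).
Proof.
move=> D z a0 b0 lsc hNy KL hz desc prox wb yB.
have D0 n : 0 <= D n by exact: enorm_ge0.
have rdec n k : (n <= k)%N -> r k <= r n.
  move=> nk; rewrite -(subnKC nk); elim: (k - n)%N => [|j IH]; first by rewrite addn0.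
  rewrite addnS; apply: le_trans IH; apply: le_trans (desc _); rewrite lerDl.
  by rewrite mulr_ge0 ?sqr_ge0 // ltW.
have [zs zs_near] : exists x, forall e : R, 0 < e ->
    forall N, exists2 n, (N <= n)%N & enorm (z n - x) < e.
  apply: (@frequently_near _ _ (B + B)) => n.
  apply: le_trans (enorm_submx_le _) _.
  by rewrite row_mxKl row_mxKr lerD.
(* Lower semicontinuity at the cluster point bounds [r] below at arbitrarily late indices, and
   monotonicity carries this to all. *)
have [c rc] : exists c, forall n, c <= r n.
  have [c hc] : exists c : R, (c%:E < h zs)%E.
    case: (h zs) (hNy zs) => [l _|_|//]; last by exists 0; rewrite ltry.
    by exists (l - 1); rewrite lte_fin; lra.
  have [V Vzs Vh] := lsc zs c hc.
  have [e e0 eV] := (nbhs_enorm _ _).1 Vzs.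
  exists c => n; have [k nk /eV /Vh] := zs_near e e0 n.
  by rewrite hz lte_fin => /ltW /le_trans; apply; exact: rdec.
have D_small (e : R) : 0 < e -> exists N, forall n, (N <= n)%N -> D n < e.
  move=> e0; have ae : 0 < a * e ^+ 2 by rewrite mulr_gt0 // exprn_gt0.
  have cr : cvgn r.
    apply: nonincreasing_is_cvgn; first by move=> n k; exact: rdec.
    by exists c => _ [n _ <-].
  have [N _ Nh] : \forall n \near \oo, `|limn r - r n| < a * e ^+ 2 / 2.
    by move/cvgrPdist_lt : cr; apply; rewrite divr_gt0.
  (* Descent bounds [D n.+1] by a drop of [r] but says nothing of [D 0], hence the shift. *)
  exists N.+1 => -[//|n]; rewrite ltnS => Nn.
  have := Nh n Nn; have := Nh n.+1 (leqW Nn); rewrite /= !ltr_norml.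
  move=> /andP[h1 h2] /andP[h3 h4].
  have : a * D n.+1 ^+ 2 < a * e ^+ 2 by have := desc n; lra.
  by rewrite ltr_pM2l // ltr_pXn2r // nnegrE // ltW.
(* Subgradients are known at [z n.+1], so the cluster index must be a successor. No monotonicity of
   [nk] is needed: [k <= nk k] suffices for limits. *)
have /choice[nk nkP] : forall k, exists n,
    (k <= n)%N /\ enorm (z n.+1 - zs) < k.+1%:R^-1.
  move=> k; have k0 : 0 < k.+1%:R^-1 :> R by rewrite invr_gt0.
  have [[//|n] kn zn] := zs_near _ k0 k.+1; by exists n.
have small_inv (e : R) : 0 < e -> exists N, forall n, (N <= n)%N -> n.+1%:R^-1 < e.
  move=> e0; exists (Num.bound e^-1) => n Nn.
  rewrite invf_plt ?posrE //; apply: lt_le_trans (archi_boundP _) _.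
    by rewrite invr_ge0 ltW.
  by rewrite ler_nat ltnW.
have zcv : z (nk k).+1 @[k --> \oo] --> zs.
  apply/cvg_enorm => e /small_inv[N Nh]; exists N => n Nn.
  exact: lt_trans (nkP n).2 (Nh n Nn).
have wcv : w (nk k) @[k --> \oo] --> (0 : 'rV[R]_(m + m)).
  apply/cvg_enorm => e e0; have e2 : 0 < e / (2 * b) by rewrite divr_gt0 // mulr_gt0.
  have [N Nh] := D_small _ e2; exists N => n Nn; rewrite subr0.
  have nkn := leq_trans Nn (nkP n).1.
  apply: le_lt_trans (wb _) _.
  apply: (@lt_le_trans _ _ (b * (e / (2 * b) + e / (2 * b)))).
    by rewrite ltr_pM2l // ltrD // Nh // leqW.
  by rewrite le_eqVlt; apply/orP; left; apply/eqP; field; rewrite gt_eqF.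
have [zs_crit [l hl rl]] := limiting_subdiff_of_proximal lsc (hNy zs)
  (fun k => hz (nk k).+1) (fun k => rdec 0%N (nk k).+1 isT)
  (fun k => prox (nk k)) zcv wcv.
have lr n : l <= r n.
  rewrite leNgt; apply/negP => rnl.
  have rl0 : 0 < l - r n by rewrite subr_gt0.
  have [N _ Nh] : \forall k \near \oo, `|l - r (nk k).+1| < l - r n.
    by move/cvgrPdist_lt : rl; exact.
  have := Nh (maxn N n) (leq_maxl _ _); rewrite /= ltr_norml => /andP[_].
  have := rdec n (nk (maxn N n)).+1; rewrite leqW ?(leq_trans (leq_maxr N n) (nkP _).1) //.
  by move=> /(_ isT); lra.
have r_near (e : R) : 0 < e -> exists N, forall n, (N <= n)%N -> r n < l + e.
  move=> e0; have [N _ Nh] : \forall k \near \oo, `|l - r (nk k).+1| < e.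
    by move/cvgrPdist_lt : rl; exact.
  exists (nk N).+1 => n /rdec; have := Nh N (leqnn N); rewrite /= ltr_norml.
  by move=> /andP[h1 _]; lra.
pose p := lsubmx zs.
have yp_le n : enorm (y n.+1 - p) <= enorm (z n - zs).
  apply: le_trans (enorm_lsubmx_le _).
  by rewrite linearB /= row_mxKl.
(* The cluster point lies on the diagonal because the step lengths tend to 0. *)
have pE : rsubmx zs = p.
  apply/eqP; rewrite eq_sym -subr_eq0; apply/eqP/enorm_eq0/eqP.
  rewrite eq_le enorm_ge0 andbT; apply/ler_addgt0Pr => e e0; rewrite add0r.
  have e3 : 0 < e / 3 by rewrite divr_gt0.
  have [N Nh] := D_small _ e3; have [n Nn zn] := zs_near _ e3 N.
  have := enorm_dist_triangle (y n.+1) p (rsubmx zs).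
  have := enorm_dist_triangle (y n) (y n.+1) (rsubmx zs).
  have : enorm (y n - rsubmx zs) <= enorm (z n - zs).
    by apply: le_trans (enorm_rsubmx_le _); rewrite linearB /= row_mxKr.
  have := yp_le n; have := Nh n Nn; rewrite /D [enorm (p - y _)]enormB; lra.
have [eta [U [phi [eta0 Uzs dphi KLU]]]] := KL zs (ex_intro _ 0 zs_crit).
have [rho0 rho00 rhoU] := (nbhs_enorm _ _).1 Uzs.
pose s n := r n - l.
have s0 n : 0 <= s n by rewrite subr_ge0.
have [Ne s_eta] : exists N, forall n, (N <= n)%N -> ((s n)%:E < eta)%E.
  case: eta eta0 {dphi KLU} => [e e0|_|//]; last by exists 0%N => n _; rewrite ltry.
  have [N Nh] := r_near e e0; exists N => n /Nh rn.
  by rewrite lte_fin ltrBlDl.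
have [[_ phi_cont phi_ge0 phi0] _ _ dphi_gt0] := dphi.
have psi0 n : (Ne <= n)%N -> 0 <= phi (s n).
  by move=> Nn; apply: phi_ge0; split; [exact: s0|exact: s_eta].
have psi_small (e : R) : 0 < e -> exists N, forall n, (N <= n)%N -> phi (s n) < e.
  move=> e0; move/subspace_continuousP : phi_cont => /(_ 0 (conj (lexx 0) eta0)).
  move=> /cvgrPdist_lt/(_ e e0)[e' /= e'0 e'h].
  have [N Nh] := r_near e' e'0.
  exists (maxn N Ne) => n; rewrite geq_max => /andP[Nn Nen].
  have sE : `|0 - s n| < e'.
    by rewrite sub0r normrN ger0_norm // ltrBlDl; exact: Nh.
  have : `|phi 0 - phi (s n)| < e := e'h (s n) sE (conj (s0 n) (s_eta n Nen)).
  by rewrite phi0 sub0r normrN ger0_norm // psi0.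
(* The distance to the subdifferential is at most the norm of its element [w n]; [0 < s n.+1] is the
   strict inequality in the KL property. *)
have slope n : U (z n.+1) -> (Ne <= n.+1)%N -> 0 < s n.+1 ->
    1 <= derive1 phi (s n.+1) * (b * (D n.+1 + D n)).
  move=> Uz Nn sn; have p0 := dphi_gt0 (s n.+1) (conj sn (s_eta _ Nn)).
  have := KLU _ Uz; rewrite hl hz lte_fin -EFinD /= => KLz.
  rewrite -lee_fin; apply: le_trans (KLz _ _) _.
  - by rewrite -subr_gt0.
  - by have := s_eta _ Nn; rewrite /s EFinB lteBlDl.
  rewrite EFinM lee_pmul2l ?lte_fin //.
  apply: (@le_trans _ _ (enorm (0 - w n))%:E).
    apply: ereal_inf_lbound; exists (w n) => //.
    by apply: frechet_limiting; exact: proximal_frechet (hz _) (prox n).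
  by rewrite lee_fin sub0r enormN.
have c0 : 0 <= b / a by rewrite divr_ge0 // ltW.
have step n : (Ne <= n)%N -> enorm (y n.+2 - p) < rho0 / 2 ->
    enorm (y n.+1 - p) < rho0 / 2 ->
    D n.+2 <= (D n.+1 + D n) / 4 + b / a * (phi (s n.+1) - phi (s n.+2)).
  move=> Nn y2 y1; apply: (desingularized_step dphi) => //.
  - exact: s_eta (leqW Nn).
  - by have := desc n.+1; rewrite /s; lra.
  (* Two halves within [rho0 / 2] place the pair within [rho0] of [zs]. *)
  - apply: slope (leqW Nn); apply: rhoU; rewrite -[zs]hsubmxK pE.
    by apply: le_lt_trans (enorm_row_mxB_le _ _ _ _) _; lra.
have trap (e : R) : 0 < e -> exists N, forall k,
    enorm (y (N + k).+1 - p) < e /\ \sum_(i < k) D (N + i).+2 <= e.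
  move=> e0; pose rho := Num.min e (rho0 / 2).
  have rhoe : rho <= e by rewrite ge_min lexx.
  have rho2 : rho <= rho0 / 2 by rewrite ge_min lexx orbT.
  have rho_gt0 : 0 < rho by rewrite lt_min e0 divr_gt0.
  (* Eighths suffice: after the triangle inequality for [y N.+2], the starting energy is at most 2/8
     + 1/16 + 1/8 + 1/8 = 9/16 of [rho]. *)
  have d0 : 0 < rho / 8 by rewrite divr_gt0.
  have dc0 : 0 < rho / 8 / (2 * (b / a) + 1).
    by rewrite divr_gt0 // ltr_wpDl // mulr_ge0.
  have [N1 N1h] := D_small _ d0; have [N2 N2h] := psi_small _ dc0.
  have [N] := zs_near _ d0 (maxn N1 (maxn N2 Ne)).
  rewrite !geq_max => /and3P[n1 n2 n3] zN.
  have yN := le_lt_trans (yp_le N) zN.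
  have DN := N1h _ n1; have DN1 := N1h _ (leqW n1).
  have psiN : 2 * (b / a) * phi (s N.+1) <= rho / 8.
    apply: (@le_trans _ _ ((2 * (b / a) + 1) * phi (s N.+1))).
      by rewrite [leRHS]mulrDl mul1r lerDl psi0 // leqW.
    rewrite mulrC -ler_pdivlMr; first by rewrite ltW // N2h // leqW.
    by rewrite ltr_wpDl // mulr_ge0.
  have tri := enorm_dist_triangle (y N.+1) (y N.+2) p.
  rewrite -/(D N.+1) in tri.
  exists N => k; have [||||h1 h2] :=
    @trapped_near _ _ y p (fun n => phi (s n)) (b / a) rho N c0 _ _ _ _ k.
  - by move=> n Nn; apply: psi0; apply: leqW; exact: leq_trans Nn.
  - move=> n Nn y2 y1; apply: step; first exact: leq_trans Nn.
      exact: lt_le_trans rho2.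
    exact: lt_le_trans rho2.
  - lra.
  - by rewrite -!/(D _); lra.
  by split; [exact: lt_le_trans rhoe|exact: le_trans rhoe].
split.
  exists p; apply/cvg_enorm => e /trap[N Nh]; exists N.+1 => -[//|n] Nn.
  by have [] := Nh (n - N)%N; rewrite subnKC.
have [N Nh] := trap 1 ltr01; exists (\sum_(i < N.+2) D i + 1) => n.
apply: (@le_trans _ _ (\sum_(i < N.+2 + n) D i)).
  rewrite addnC big_split_ord /= lerDl; apply: sumr_ge0 => i _; exact: D0.
by rewrite big_split_ord /= lerD2l; exact: (Nh n).2.
Qed.

(** * One step of the algorithm *)

Lemma argmin_iteration_finite (R : realType) (m : nat) (f : 'rV[R]_m -> \bar R)
    (A : 'rV[R]_m -> R) (al : R) (p : 'rV[R]_m) : proper_fun f -> 0 < al ->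
  argmin (fun u => (A u)%:E + al%:E * f u)%E p -> exists s, f p = s%:E.
Proof.
move=> [fNy [u fu]] al0 /(_ u) pu.
case: (f p) (fNy p) pu => [s _ _|_|//]; first by exists s.
rewrite /= gt0_muley ?lte_fin //=; by case: (f u) fu (fNy u).
Qed.

Section IterationStep.
Context (R : realType) (m : nat) (f : 'rV[R]_m -> \bar R) (g F : 'rV[R]_m -> R).
Context (sigma Lg LF alo ahi beta al be : R) (p c c' : 'rV[R]_m) (s : R).
Context (f_proper : proper_fun f) (g_smooth : diff_lipschitz_grad Lg g)
  (F_convex : strongly_convex sigma F) (F_smooth : diff_lipschitz_grad LF F).
Context (Lg_ge0 : 0 <= Lg) (sigma_gt0 : 0 < sigma) (LF_gt0 : 0 < LF)
  (alo_gt0 : 0 < alo) (al_bnd : alo <= al <= ahi) (be_bnd : 0 <= be <= beta).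
Context (p_min : argmin (fun u =>
  (bregman F u c + al * dot u (grad g c) + be * dot u (c' - c))%:E
  + al%:E * f u)%E p).
Context (fp : f p = s%:E).

Let al_gt0 : 0 < al.
Proof. by case/andP: al_bnd => h _; exact: lt_le_trans h. Qed.

Lemma iteration_ineq (u : 'rV[R]_m) (t : R) : f u = t%:E ->
  al * s + F p - F u + dot (grad F c) (u - p) <=
  al * t + al * dot (u - p) (grad g c) + be * dot (u - p) (c' - c).
Proof.
move=> fu; have := p_min u; rewrite fp fu -!EFinM -!EFinD lee_fin /bregman.
move: (grad F c) (grad g c) (c' - c) => GF Gg d.
by rewrite !dotBr !dotBl; lra.
Qed.

(** Minimality against [c], with strong convexity for the Bregman term, the descent lemma for [g]
    and Young's inequality for the inertial term. After division by [al], the gain is bounded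
    through [ahi] and the inertial loss through [beta / alo]. *)
Lemma iteration_descent (mu t : R) : 0 < mu -> f c = t%:E ->
  s + g p + ((sigma - ahi * Lg) / (2 * ahi) - mu * beta / (2 * alo)) *
    enorm (p - c) ^+ 2 <=
  t + g c + beta / (2 * mu * alo) * enorm (c - c') ^+ 2.
Proof.
move=> mu0 fc; have h1 := iteration_ineq fc.
have h2 := bregman_ge p (F_smooth.1 c) F_convex.
have h3 := gradient_quadratic_bound c p g_smooth.
have h4 := young_dot (p - c) (c - c') mu0.
case/andP: al_bnd => alo_al al_ahi; case/andP: be_bnd => be0 be_beta.
have ahi0 : 0 < ahi by exact: lt_le_trans al_ahi.
have nP := sqr_ge0 (enorm (p - c)); have nQ := sqr_ge0 (enorm (c - c')).
set P := enorm (p - c) ^+ 2 in h2 h3 h4 nP *.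
set Q := enorm (c - c') ^+ 2 in h4 nQ *.
have h5 : al * (s + g p) + (sigma / 2 - al * (Lg / 2)) * P <=
    al * (t + g c) + be * (mu / 2 * P + Q / (2 * mu)).
  move: h1 h2 (ler_wpM2l (ltW al_gt0) h3) (ler_wpM2l be0 h4).
  rewrite /bregman -[c - p]opprB -[c' - c]opprB; move: (grad F c) (grad g c) => Fc gc.
  rewrite !dotNr !dotNl opprK [dot gc _]dotC.
  by move: (dot _ _) (dot _ _) (dot _ _) => d1 d2 d3; lra.
have iaA : ahi^-1 <= al^-1 by rewrite lef_pV2 ?posrE.
have h6 : s + g p + (sigma / 2 / al - Lg / 2) * P <=
    t + g c + be / al * (mu / 2 * P + Q / (2 * mu)).
  rewrite -(ler_pM2l al_gt0).
  have -> : al * (s + g p + (sigma / 2 / al - Lg / 2) * P) =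
    al * (s + g p) + (sigma / 2 - al * (Lg / 2)) * P by field; rewrite gt_eqF.
  have -> : al * (t + g c + be / al * (mu / 2 * P + Q / (2 * mu))) =
    al * (t + g c) + be * (mu / 2 * P + Q / (2 * mu)); last by [].
  by field; rewrite !gt_eqF.
have h7 : be / al <= beta / alo.
  by apply: ler_pM => //; [rewrite invr_ge0 ltW|rewrite lef_pV2 ?posrE].
have h8 : be / al * (mu / 2 * P + Q / (2 * mu)) <=
    beta / alo * (mu / 2 * P + Q / (2 * mu)).
  have mu2 : 0 <= mu / 2 by rewrite divr_ge0 // ltW.
  have imu : 0 <= (2 * mu)^-1 by rewrite invr_ge0 mulr_ge0 // ltW.
  by apply: ler_wpM2r h7; rewrite addr_ge0 // mulr_ge0.
have h9 : sigma / 2 / ahi * P <= sigma / 2 / al * P.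
  by apply: ler_wpM2r => //; apply: ler_wpM2l iaA; rewrite divr_ge0 // ltW.
have -> : beta / (2 * mu * alo) * Q = beta / alo * (Q / (2 * mu)).
  by field; rewrite !gt_eqF.
have -> : ((sigma - ahi * Lg) / (2 * ahi) - mu * beta / (2 * alo)) * P =
    sigma / 2 / ahi * P - Lg / 2 * P - beta / alo * (mu / 2 * P).
  by field; rewrite !gt_eqF.
rewrite mulrDr in h8; rewrite mulrBl in h6.
by move: h6 h8 h9; lra.
Qed.

(** Fermat's rule for the subproblem, solved for a subgradient of [f] at [p] and shifted by
    [grad g p]. *)
Definition iteration_subgradient : 'rV[R]_m :=
  grad g p - grad g c - al^-1 *: (grad F p - grad F c) - (be / al) *: (c' - c).

(** Minimality against an arbitrary [u], with [F] bounded above and [g] below by their quadratic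
    models at [p]. Since [alo <= al], the constant does not depend on the step. *)
Lemma iteration_proximal : proximal_subgradient (LF / (2 * alo) + Lg / 2)
  (fun u => f u + (g u)%:E)%E p iteration_subgradient.
Proof.
move=> u; rewrite fp; case: (f u) (f_proper.1 u) (@iteration_ineq u); last 2 first.
- by move=> _ _; rewrite leey.
- by [].
move=> t _ /(_ t erefl) h1; rewrite -!EFinD lee_fin.
have h2 := gradient_quadratic_bound p u F_smooth.
have h3 := gradient_quadratic_bound_below p u g_smooth.
case/andP: al_bnd => alo_al _.
rewrite /iteration_subgradient.
move: h1 h2 h3; rewrite [dot (u - p) (grad g c)]dotC [dot (u - p) (c' - c)]dotC.
move: (grad F c) (grad F p) (grad g c) (grad g p) (c' - c) (u - p).
move=> Fc Fp gc gp e v; rewrite !dotE => h1 h2 h3.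
have h4 : LF / 2 / al * enorm v ^+ 2 <= LF / 2 / alo * enorm v ^+ 2.
  apply: ler_wpM2r; first exact: sqr_ge0.
  by apply: ler_wpM2l; [rewrite divr_ge0 // ltW|rewrite lef_pV2 ?posrE].
have h5 : s + al^-1 * (dot Fc v - dot Fp v) - LF / 2 / al * enorm v ^+ 2 <=
    t + dot gc v + be / al * dot e v.
  rewrite -(ler_pM2l al_gt0).
  have -> : al * (s + al^-1 * (dot Fc v - dot Fp v) - LF / 2 / al * enorm v ^+ 2) =
    al * s + dot Fc v - dot Fp v - LF / 2 * enorm v ^+ 2.
    by field; rewrite gt_eqF.
  have -> : al * (t + dot gc v + be / al * dot e v) =
    al * t + al * dot gc v + be * dot e v by field; rewrite gt_eqF.
  by move: h1 h2; lra.
have -> : LF / (2 * alo) = LF / 2 / alo by field; rewrite gt_eqF.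
by move: h3 h4 h5; lra.
Qed.

Lemma iteration_subgradient_le : enorm iteration_subgradient <=
  (LF / alo + Lg) * enorm (p - c) + beta / alo * enorm (c - c').
Proof.
case/andP: al_bnd => alo_al _; case/andP: be_bnd => be0 be_beta.
have ial : al^-1 <= alo^-1 by rewrite lef_pV2 ?posrE.
have ial0 : 0 <= al^-1 by rewrite invr_ge0 ltW.
have n0 := enorm_ge0.
have hF : enorm (al^-1 *: (grad F p - grad F c)) <= alo^-1 * (LF * enorm (p - c)).
  by rewrite enormZ ger0_norm //; apply: ler_pM; rewrite ?n0 //; exact: F_smooth.2.
have hb : enorm ((be / al) *: (c' - c)) <= beta / alo * enorm (c - c').
  rewrite enormZ ger0_norm ?mulr_ge0 // enormB.
  by apply: ler_wpM2r; [exact: n0|exact: ler_pM].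
have hg := g_smooth.2 p c.
rewrite /iteration_subgradient.
apply: le_trans (ler_enormD _ _) _; rewrite enormN.
apply: le_trans (lerD (ler_enormD _ _) (lexx _)) _; rewrite enormN.
apply: le_trans (lerD (lerD hg hF) hb) _.
by rewrite lerD2r mulrDl addrC mulrA [alo^-1 * _]mulrC.
Qed.
End IterationStep.

(** * Subgradients and semicontinuity of the coupled function *)

(** The coupling term is convex: it exceeds its tangent at the pair by [M] times the squared norm of
    [(u - w) - (p - q)]. So its gradient is simply added and [C] is kept. *)
Lemma proximal_coupled (R : realType) (m : nat) (C M : R) (fg : 'rV[R]_m -> \bar R)
    (p q v : 'rV[R]_m) : 0 <= C -> 0 <= M -> (forall u, -oo < fg u)%E ->
  proximal_subgradient C fg p v ->
  proximal_subgradient C (on_pairs (fun u w => fg u + (M * enorm (u - w) ^+ 2)%:E)%E)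
    (row_mx p q) (row_mx (v + (2 * M) *: (p - q)) (- ((2 * M) *: (p - q)))).
Proof.
move=> C0 M0 fgNy prox z; rewrite /on_pairs row_mxKl row_mxKr.
rewrite dot_submx enorm_sqr_submx !(linearB lsubmx, linearB rsubmx) /= !row_mxKl !row_mxKr.
have := prox (lsubmx z); move: (lsubmx z) (rsubmx z) => u w.
have {}fgu := fgNy u; have {}fgp := fgNy p.
case: (fg u) fgu => [t _|_|//]; last first.
  by move=> _; apply: le_trans (leey _) _; rewrite addye.
case: (fg p) fgp => [s _|_|//]; last by rewrite addye.
rewrite -!EFinD !lee_fin !enorm_sqr => h.
have hq := dot_ge0 ((u - w) - (p - q)).
have hw := mulr_ge0 C0 (dot_ge0 (w - q)).
have hM := mulr_ge0 M0 hq.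
move: h hw hM; rewrite !dotE.
rewrite ?(dotC w u) ?(dotC p u) ?(dotC q u) ?(dotC p w) ?(dotC q w) ?(dotC q p).
by lra.
Qed.

Lemma lower_semicontinuousD (R : realType) (d : nat) (f : 'rV[R]_d -> \bar R)
    (c : 'rV[R]_d -> R) : (forall u, -oo < f u)%E -> lower_semicontinuous f ->
  continuous c -> lower_semicontinuous (fun u => f u + (c u)%:E)%E.
Proof.
move=> fNy lsc cc x a ax.
(* The level [a] is split into [b] below [f x] and [a - b] below [c x]. *)
have [b [bx ab]] : exists b, (b%:E < f x)%E /\ a - c x < b.
  case: (f x) (fNy x) ax => [l _|_ _|//]; last by exists (a - c x + 1); rewrite ltry; split=> //; lra.
  rewrite -EFinD lte_fin => al; exists ((l + (a - c x)) / 2); rewrite lte_fin.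
  by split; lra.
have [V Vx Vb] := lsc x b bx.
have W : nbhs x (c @^-1` [set s | a - b < s]).
  by apply: cc; apply: lt_nbhsr; rewrite ltrBlDl -ltrBlDr.
exists (V `&` c @^-1` [set s | a - b < s]); first exact: filterI.
move=> y [/Vb by_ /= cy].
case: (f y) (fNy y) by_ => [l _|_ _|//]; last by rewrite addye // ltry.
by rewrite -EFinD !lte_fin => bl; lra.
Qed.

Lemma lower_semicontinuous_comp (R : realType) (d k : nat)
    (f : 'rV[R]_d -> \bar R) (phi : 'rV[R]_k -> 'rV[R]_d) :
  continuous phi -> lower_semicontinuous f ->
  lower_semicontinuous (fun u => f (phi u)).
Proof.
move=> cphi lsc x a /lsc[V Vx Va]; exists (phi @^-1` V); first exact: cphi.
by move=> y /Va.
Qed.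

Lemma continuous_enorm (R : realType) (d : nat) :
  continuous (@enorm R d).
Proof.
move=> x; apply/(cvgrPdist_lt (F := nbhs x)) => e e0; apply/nbhs_enorm; exists e => // y yx.
have := enorm_dist_triangle x y 0; have := enorm_dist_triangle y x 0.
rewrite !subr0 [enorm (x - y)]enormB /= ltr_norml; lra.
Qed.

(** * Reduction of the algorithm to the abstract scheme *)

Theorem theorem12 (R : realType) (m : nat) (m_ge1 : (1 <= m)%N)
    (f : 'rV[R]_m -> \bar R) (g F : 'rV[R]_m -> R) (sigma Lg LF : R)
    (f_proper : proper_fun f) (f_lsc : lower_semicontinuous f)
    (f_bounded : bounded_below f)
    (Lg_ge0 : 0 <= Lg) (g_smooth : diff_lipschitz_grad Lg g)
    (sigma_gt0 : 0 < sigma) (LF_gt0 : 0 < LF)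
    (F_convex : strongly_convex sigma F) (F_smooth : diff_lipschitz_grad LF F)
    (mu alo beta : R) (mu_gt0 : 0 < mu) (alo_gt0 : 0 < alo)
    (beta_ge0 : 0 <= beta)
    (mu_cond : mu * (sigma - Lg * alo) > beta * (mu ^+ 2 + 1))
    (ahi : R) (alo_lt_ahi : alo < ahi) :
  let M1 := (sigma - ahi * Lg) / (2 * ahi) - (mu * beta) / (2 * alo) in
  let M2 := beta / (2 * mu * alo) in
  let fg : 'rV[R]_m -> \bar R := fun x => (f x + (g x)%:E)%E in
  let H : 'rV[R]_m -> 'rV[R]_m -> \bar R :=
    fun x y => (fg x + (M2 * enorm (x - y) ^+ 2)%:E)%E in
  forall (M_cond : M1 > M2) (fg_coercive : coercive fg)
    (H_KL : KL_function (on_pairs H))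
    (x : nat -> 'rV[R]_m)
    (x_gen : generated_by_algorithm f g F alo ahi beta x),
  (\sum_(0 <= n <oo) (enorm (x n.+1 - x n))%:E < +oo)%E /\
  (exists xlim : 'rV[R]_m, crit fg xlim /\ x n @[n --> \oo] --> xlim).
Proof.
move=> M1 M2 fg H M_cond fg_coercive H_KL x [alphas [betas [param_bnd x_min]]].
have M20 : 0 <= M2 by rewrite divr_ge0 // !mulr_ge0 // ltW.
have M12 : 0 < M1 - M2 by rewrite subr_gt0.
have M22 : 0 <= 2 * M2 by rewrite pmulr_rge0.
have LFalo0 : 0 <= LF / alo by rewrite divr_ge0 // ltW.
have betalo0 : 0 <= beta / alo by rewrite divr_ge0 // ltW.
have fgNy u : (-oo < fg u)%E.
  by rewrite /fg ltNye; case: (f u) (f_proper.1 u).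
have al_bnd n : alo <= alphas n.+1 <= ahi by case: (param_bnd n.+1 isT).
have be_bnd n : 0 <= betas n.+1 <= beta by case: (param_bnd n.+1 isT).
have al0 n : 0 < alphas n.+1 by case/andP: (al_bnd n) => h _; exact: lt_le_trans h.
(* The starting points are arbitrary and may lie outside the domain of [f]; [x 2] is the first
   computed iterate. *)
have /choice[s fs] : forall n, exists s, f (x n.+2) = s%:E.
  by move=> n; exact: argmin_iteration_finite f_proper (al0 n) (x_min n.+1 isT).
pose D n := enorm (x n.+2 - x n.+1).
pose r n := s n + g (x n.+2) + M2 * D n ^+ 2.
pose v n := iteration_subgradient g F (alphas n.+2) (betas n.+2)
  (x n.+3) (x n.+2) (x n.+1).
pose w n := row_mx (v n + (2 * M2) *: (x n.+3 - x n.+2))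
  (- ((2 * M2) *: (x n.+3 - x n.+2))).
pose C := LF / (2 * alo) + Lg / 2.
have C0 : 0 <= C by rewrite addr_ge0 ?divr_ge0 ?mulr_ge0 // ltW.
pose K := LF / alo + Lg + beta / alo.
have K0 : 0 <= K by rewrite !addr_ge0.
(* [K] bounds [v], the two blocks of the coupling gradient cost [2 * M2] each, and 1 ensures
   positivity. *)
pose b := K + 4 * M2 + 1.
have b0 : 0 < b by rewrite ltr_wpDl // addr_ge0 // mulr_ge0.
have D0 n : 0 <= D n by exact: enorm_ge0.
have Hr n : on_pairs H (row_mx (x n.+2) (x n.+1)) = (r n)%:E.
  by rewrite /on_pairs row_mxKl row_mxKr /H /fg fs.
have desc n : r n.+1 + (M1 - M2) * D n.+1 ^+ 2 <= r n.
  have := iteration_descent g_smooth F_convex F_smooth sigma_gt0 alo_gt0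
    (al_bnd n.+1) (be_bnd n.+1) (x_min n.+2 isT) (fs n.+1) mu_gt0 (fs n).
  rewrite -/M1 -/M2 /r -/(D n.+1) -/(D n).
  by move: (D _ ^+ 2) (D _ ^+ 2) => P Q; lra.
have v_prox n : proximal_subgradient C fg (x n.+3) (v n).
  exact: iteration_proximal f_proper g_smooth F_smooth LF_gt0 alo_gt0
    (al_bnd n.+1) (x_min n.+2 isT) (fs n.+1).
have v_le n : enorm (v n) <= K * (D n.+1 + D n).
  have := iteration_subgradient_le (x n.+3) (x n.+2) (x n.+1) g_smooth
    F_smooth alo_gt0 (al_bnd n.+1) (be_bnd n.+1).
  rewrite -/(v n) -/(D n.+1) -/(D n) => /le_trans; apply.
  rewrite mulrDr lerD // ler_wpM2r // /K; first by rewrite lerDl.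
  by rewrite lerDr addr_ge0.
have w_prox n : proximal_subgradient C (on_pairs H)
    (row_mx (x n.+3) (x n.+2)) (w n).
  exact: proximal_coupled C0 M20 fgNy (v_prox n).
have w_le n : enorm (w n) <= b * (D n.+1 + D n).
  apply: le_trans (enorm_submx_le _) _; rewrite row_mxKl row_mxKr.
  have := ler_enormD (v n) ((2 * M2) *: (x n.+3 - x n.+2)).
  rewrite enormN !enormZ (ger0_norm M22) -/(D n.+1).
  have := v_le n; have := D0 n; have := D0 n.+1.
  have := mulr_ge0 M20 (D0 n).
  by rewrite /b; move: (enorm _) (enorm _) (D _) (D _) => A1 A2 A3 A4; lra.
have lscH : lower_semicontinuous (on_pairs H).
  have -> : on_pairs H = (fun z => f (lsubmx z) +
      (g (lsubmx z) + M2 * enorm (lsubmx z - rsubmx z) ^+ 2)%:E)%E.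
    by apply/funext => z; rewrite /on_pairs /H /fg EFinD addeA.
  apply: lower_semicontinuousD; first by move=> u; exact: f_proper.1.
    exact: lower_semicontinuous_comp (@continuous_lsubmx _ _ _ _) f_lsc.
  have cE : continuous (fun z : 'rV[R]_(m + m) => enorm (lsubmx z - rsubmx z)).
    move=> z; apply: (@continuous_comp _ _ _ (fun z => lsubmx z - rsubmx z)).
      apply: (cvgB (F := nbhs z)); first exact: continuous_lsubmx.
      exact: continuous_rsubmx.
    exact: continuous_enorm.
  move=> z; apply: (cvgD (F := nbhs z)).
    apply: continuous_comp; first exact: continuous_lsubmx.
    exact/differentiable_continuous/g_smooth.1.
  apply: (cvgM (F := nbhs z)); first exact: cvg_cst.
  by rewrite expr2; apply: (cvgM (F := nbhs z)); exact: cE.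
have HNy u : (-oo < on_pairs H u)%E.
  by rewrite /on_pairs /H ltNye; case: (fg _) (fgNy (lsubmx u)).
have r_le n : r n <= r 0%N.
  elim: n => // n IH; apply: le_trans IH; apply: le_trans (desc _).
  by rewrite lerDl mulr_ge0 ?sqr_ge0 // ltW.
have fg_le n : s n + g (x n.+2) <= r 0%N.
  by apply: le_trans (r_le n); rewrite lerDl mulr_ge0 ?sqr_ge0.
have [rad radP] := fg_coercive (r 0%N).
(* From [x 2] on the iterates stay in a bounded sublevel set of [fg]; [x 1] need not, so its norm
   enters the maximum. *)
have x_bnd n : enorm (x n.+1) <= Num.max rad (enorm (x 1%N)).
  case: n => [|n]; first by rewrite le_max lexx orbT.
  rewrite le_max; apply/orP; left; rewrite leNgt; apply/negP => /radP.
  by rewrite /fg fs -EFinD lte_fin ltNge fg_le.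
have [[p xp] [S SP]] := KL_descent_cvg (y := fun n => x n.+1)
  M12 b0 lscH HNy H_KL Hr desc w_prox w_le x_bnd.
have xcv : x n @[n --> \oo] --> p by rewrite -cvg_shiftS.
split.
  (* The scheme runs on [x n.+1], so the first step length is added separately. *)
  apply: (@le_lt_trans _ _ (enorm (x 1%N - x 0%N) + S)%:E); last exact: ltry.
  apply: lime_le.
    by apply: is_cvg_nneseries => n _ _; rewrite lee_fin enorm_ge0.
  exists 1%N => // -[//|n] _; rewrite /= sumEFin lee_fin big_mkord big_ord_recl /=.
  by rewrite lerD2l; exact: SP.
exists p; split => //.
(* Criticality is obtained for [fg] itself: its proximal subgradients [v n] vanish along the whole
   convergent sequence. *)
have v0 : v n @[n --> \oo] --> (0 : 'rV[R]_m).
  apply/cvg_enorm => e e0.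
  have K1 : 0 < 4 * (K + 1) by rewrite mulr_gt0 // ltr_wpDl.
  have [N Nh] := (cvg_enorm _ _).1 xcv _ (divr_gt0 e0 K1).
  have ND n : (N <= n)%N -> D n <= 2 * (e / (4 * (K + 1))).
    move=> Nn; apply: le_trans (enorm_dist_triangle p _ _) _.
    rewrite [enorm (p - _)]enormB.
    by have := Nh _ (leqW Nn); have := Nh _ (leqW (leqW Nn)); lra.
  exists N => n Nn; rewrite subr0; apply: le_lt_trans (v_le n) _.
  have DD : D n.+1 + D n <= e / (K + 1).
    have -> : e / (K + 1) = 2 * (e / (4 * (K + 1))) + 2 * (e / (4 * (K + 1))).
      by field; rewrite gt_eqF // ltr_wpDl.
    by rewrite lerD ?ND // leqW.
  apply: le_lt_trans (ler_wpM2l K0 DD) _.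
  by rewrite mulrCA gtr_pMr // ltr_pdivrMr ?ltr_wpDl // mul1r ltrDl.
have xs3 : x n.+3 @[n --> \oo] --> p.
  by rewrite (cvg_shiftS (fun n => x n.+2)) (cvg_shiftS (fun n => x n.+1)).
have fgx n : fg (x n.+3) = (s n.+1 + g (x n.+3))%:E by rewrite /fg fs.
have lscfg : lower_semicontinuous fg.
  apply: lower_semicontinuousD f_lsc _; first exact: f_proper.1.
  by move=> u; exact/differentiable_continuous/g_smooth.1.
by have [] := limiting_subdiff_of_proximal lscfg (fgNy p) fgx
  (fun n => fg_le n.+1) v_prox xs3 v0.
Qed.
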